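(* Let $\mathbb{K}$ be a field. There exists a non-thin $\mathbb{K}$-subalgebra of $\mathbb{K}[x]/x^{14}$. Moreover, $n=14$ is the minimal $n$ with this property; that is, for every $1\le n\le 13$ all $\mathbb{K}$-subalgebras of $\mathbb{K}[x]/x^n$ are thin.
   Context: Subalgebras are unital. A $\mathbb{K}$-subalgebra $R\subseteq\mathbb{K}[x]/x^n$ is a local ring with maximal ideal $\mathfrak{m}$ (its elements with zero constant term). Its exponent set $E=E(R)\subseteq[0,n-1]=\{0,\dots,n-1\}$ is the set of $x$-adic valuations of nonzero elements of $R$; it contains $0$ and is closed under those sums that are $\le n-1$. Put $E_{>0}=E\setminus\{0\}$, $E^{(2)}=(E_{>0}+E_{>0})\cap[1,n-1]$ and $d(E)=\#(E_{>0}\setminus E^{(2)})$ (the minimal number of generators of $E$ as a partial monoid). $R$ is called thin if $\dim_{\mathbb{K}}(\mathfrak{m}/\mathfrak{m}^2)=d(E)$, and non-thin otherwise. *)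

(* Defs.v *)
From HB Require Import structures.
From mathcomp Require Import all_boot all_order all_algebra all_field boolp.

Set Implicit Arguments.
Unset Strict Implicit.
Unset Printing Implicit Defensive.

Import GRing.Theory.
Local Open Scope ring_scope.

(* K[x]/x^n for n >= 1; elements are represented by the polynomials of degree
   < n.  Beware that {poly %/ 'X^0} is not the zero ring: the library falls
   back to the modulus 'X there, so n = 0 has to be excluded. *)
Notation trunc_poly K n := {poly %/ ('X^n : {poly K})}.

HB.instance Definition _ (K : fieldType) (h : {poly K}) := Vector.on {poly %/ h}.

Section ThinSubalgebras.
Variables (K : fieldType) (n : nat).
Implicit Types (f : trunc_poly K n) (R : {vspace trunc_poly K n}).

Definition const_coef f : K^o := (f : {poly K})`_0.

Fact const_coef_is_linear : linear const_coef.
Proof. by move=> a f g; rewrite /const_coef coefD coefZ. Qed.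

HB.instance Definition _ :=
  GRing.isLinear.Build K (trunc_poly K n) K^o _ const_coef const_coef_is_linear.

(* The maximal ideal of R when R is a unital subalgebra. *)
Definition max_ideal R : {vspace trunc_poly K n} :=
  (R :&: lker (linfun const_coef))%VS.

Lemma mem_max_ideal R f :
  (f \in max_ideal R) = (f \in R) && ((f : {poly K})`_0 == 0).
Proof. by rewrite memv_cap memv_ker lfunE. Qed.

Lemma max_ideal_sqr_sub R :
  (R * R <= R)%VS -> (max_ideal R ^+ 2 <= max_ideal R)%VS.
Proof.
move=> RR; rewrite expv2; apply/prodvP => f g.
rewrite !mem_max_ideal => /andP[fR /eqP f0] /andP[gR _].
rewrite (subvP RR) ?memv_mul //= [X in Pdiv.CommonRing.rmodp _ X]mk_monic_Xn.
rewrite -Pdiv.RingMonic.take_poly_rmodp coef_take_poly /= coef0M.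
by rewrite f0 mul0r.
Qed.

(* dim (m / m^2); the truncated subtraction is exact when R is a subalgebra,
   by max_ideal_sqr_sub. *)
Definition cotangent_dim R : nat :=
  (\dim (max_ideal R) - \dim (max_ideal R ^+ 2))%N.

(* The x-adic valuation of f != 0 is the multiplicity mup 0 f of its root 0. *)
Definition exponent_set R : {set 'I_n} :=
  [set i : 'I_n |
    `[< exists f, [/\ f \in R, f != 0 & mup 0 (f : {poly K}) = i] >]].

End ThinSubalgebras.

Section PartialMonoidGenerators.
Variable n : nat.
Implicit Types E : {set 'I_n}.

Definition pos_part E : {set 'I_n} := [set i in E | (0 < i)%N].

Definition double_sum E : {set 'I_n} :=
  [set k : 'I_n | (0 < k)%N &&
    [exists i in pos_part E, [exists j in pos_part E, k == (i + j)%N :> nat]]].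

Definition num_gens E : nat := #|pos_part E :\: double_sum E|.

End PartialMonoidGenerators.

Definition thin (K : fieldType) (n : nat) (R : {vspace trunc_poly K n}) : Prop :=
  cotangent_dim R = num_gens (exponent_set R).

(* Main.v *)
From HB Require Import structures.
Require Import Defs.
From mathcomp Require Import all_boot all_order all_algebra all_field.
From mathcomp Require Import boolp ring zify.

(** A subspace of K[x]/x^n has as many valuations as its dimension
    ([dim_exponent_set]).  Hence dim m/m^2 = #E_{>0} - #E(m^2), and since
    E^(2) <= E(m^2) <= E_{>0}, thinness says that no cancellation between
    products of elements of m creates a valuation outside E^(2) ([thinP]).

    For n = 14 such a cancellation exists.  Put f4 = x^4 + x^5 and
    f6 = x^6 + x^7.  Then f4^3 - f6^2 = x^13 (1 + x)^2 in every characteristic,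
    and f4, f6 lie in an algebra whose exponents below 12 are 0, 4, 6, 8, 10,
    so that 13 is not a sum of two positive exponents.

    For n <= 13, suppose that v is the valuation of some h in m^2 but not a sum
    of two positive exponents.  Let G_k be the span of the products f g with
    val f >= i, val g >= k - i for some 0 < i < k.  Let s be the least exponent
    such that k = s + t for an exponent t, and let a, b have valuations s, t.
    If every other splitting k = i + j satisfies i - s in E or j - s in E, then
    moving an element of valuation i - s (or j - s) from one factor to the other
    shows that f g is a multiple of a b modulo G_{k+1}
    ([exchange_products]); so an element of G_k without x^k term lies in
    G_{k+1} ([products_geS]).  By induction h is in G_v, whose elements have no
    x^v term: a contradiction.

    The exchange property of E holds for k < v <= 12 ([exchange]).  It is
    trivial unless s < i, j, so s <= 4 because k <= 11.  As E is closed under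
    adding s, no exponent below v is congruent to v modulo s; this settles
    s = 1, 2, 3, and the few sums with s = 4 are excluded by v = 5 + 6 and
    v = 8 + 4.  The algebra for n = 14 is the first failure: s = 4 and
    4 + 8 = 6 + 6 = 12, while 6 - 4 = 2 is not an exponent. *)

Set Implicit Arguments.
Unset Strict Implicit.
Unset Printing Implicit Defensive.

Import GRing.Theory.
Local Open Scope ring_scope.

(** * Valuations and dimension *)

Section Valuations.
Variables (K : fieldType) (n : nat).
Implicit Types (f g : trunc_poly K n) (U V : {vspace trunc_poly K n}).

Definition coef_at i f : K^o := (f : {poly K})`_i.

Fact coef_at_is_linear i : linear (coef_at i).
Proof. by move=> a f g; rewrite /coef_at coefD coefZ. Qed.

HB.instance Definition _ i :=
  GRing.isLinear.Build K (trunc_poly K n) K^o _ (coef_at i)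
    (coef_at_is_linear i).

Definition val_ge i f := forall j, (j < i)%N -> coef_at j f = 0.

Lemma val_geW i j f : (j <= i)%N -> val_ge i f -> val_ge j f.
Proof. by move=> ji fi l lj; apply: fi; apply: leq_trans lj ji. Qed.

Lemma val_geS i f : val_ge i f -> coef_at i f = 0 -> val_ge i.+1 f.
Proof. by move=> fi fi0 j; rewrite ltnS leq_eqVlt => /orP[/eqP->|/fi]. Qed.

(** Exponents as a predicate on natural numbers, which is easier to do
    arithmetic with than the set of ordinals [exponent_set V]. *)
Definition has_val V i :=
  exists f, [/\ f \in V, val_ge i f & coef_at i f != 0].

Lemma mup0P (p : {poly K}) i : p != 0 ->
  reflect (forall j, (j < i)%N -> p`_j = 0) (i <= mup 0 p)%N.
Proof.
move=> p0; rewrite mup_geq // subr0; apply: (iffP idP).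
  by case/dvdpP=> q -> j ji; rewrite coefMXn ji.
move=> p_i; apply/dvdpP; exists (drop_poly i p).
rewrite -[LHS](poly_take_drop i) [take_poly _ _](_ : _ = 0) ?add0r //.
by apply/polyP => j; rewrite coef_take_poly coef0; case: ifP => // /p_i.
Qed.

Lemma mem_exponent_set V (i : 'I_n) : i \in exponent_set V <-> has_val V i.
Proof.
have mupE f : f != 0 ->
    mup 0 (f : {poly K}) = i <-> val_ge i f /\ coef_at i f != 0.
  move=> f0; have le_mup j := mup0P j f0; split=> [fi|[fi fi0]].
    have fi' : val_ge i f by apply/le_mup; rewrite fi.
    split=> //; apply/negP => /eqP /(val_geS fi') /le_mup.
    by rewrite fi ltnn.
  apply/eqP; rewrite eqn_leq; apply/andP; split; last exact/le_mup.
  by rewrite leqNgt; apply: contra fi0 => /le_mup/(_ i (ltnSn i))/eqP.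
rewrite inE; split=> [/asboolP[f [fV f0 /(mupE _ f0)[]]]|[f [fV fi fi0]]].
  by exists f.
have f0 : f != 0 by apply: contraNneq fi0 => ->; rewrite linear0.
by apply/asboolP; exists f; split=> //; apply/mupE.
Qed.

Lemma exponent_setS U V :
  (U <= V)%VS -> exponent_set U \subset exponent_set V.
Proof.
move=> /subvP UV; apply/subsetP => i /mem_exponent_set[f [/UV fV fi fi0]].
by apply/mem_exponent_set; exists f.
Qed.

Lemma double_sumP V (k : 'I_n) :
  k \in double_sum (exponent_set V) <->
  exists i j, [/\ (0 < i)%N, (0 < j)%N, has_val V i, has_val V j
                & k = (i + j)%N :> nat].
Proof.
rewrite inE; split=> [/andP[_ /exists_inP[i Ei /exists_inP[j Ej /eqP kE]]]|].
  move: Ei Ej; rewrite ![_ \in pos_part _]inE.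
  move=> /andP[/mem_exponent_set Ei i_gt0] /andP[/mem_exponent_set Ej j_gt0].
  by exists i, j.
case=> i [j [i_gt0 j_gt0 Ei Ej kE]]; apply/andP; split; first by lia.
have i_n : (i < n)%N by have := ltn_ord k; lia.
have j_n : (j < n)%N by have := ltn_ord k; lia.
apply/exists_inP; exists (Ordinal i_n).
  by rewrite [_ \in _]inE i_gt0 andbT; apply/mem_exponent_set.
apply/exists_inP; exists (Ordinal j_n); last by apply/eqP.
by rewrite [_ \in _]inE j_gt0 andbT; apply/mem_exponent_set.
Qed.

Fixpoint tailv V i : {vspace trunc_poly K n} :=
  if i is j.+1 then (tailv V j :&: lker (linfun (coef_at j)))%VS else V.

Lemma mem_tailv V i f : f \in tailv V i <-> f \in V /\ val_ge i f.
Proof.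
elim: i => [|i IHi] /=; first by split=> [|[]].
rewrite memv_cap memv_ker lfunE /=; split.
  by case/andP=> /IHi[fV fi] /eqP/(val_geS fi).
case=> fV fi; apply/andP; split; last by apply/eqP/fi.
by apply/IHi; split=> //; apply: val_geW fi.
Qed.

(** Rank-nullity for the coefficient functional at i: its image on the elements
    of valuation at least i is nonzero exactly when i is a valuation. *)
Lemma dim_tailv V i :
  \dim (tailv V i) = (`[< has_val V i >] + \dim (tailv V i.+1))%N.
Proof.
rewrite -(limg_ker_dim (linfun (coef_at i)) (tailv V i)) /= addnC.
congr (_ + _)%N.
set W := (_ @: _)%VS.
have W1 : (\dim W <= 1)%N by rewrite (leq_trans (dimvS (subvf _))) // dimvf.
apply/eqP; rewrite eqn_leq; apply/andP; split.
  have [W0|] := eqVneq W 0%VS; first by rewrite W0 dimv0.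
  rewrite -subv0 => /subvPn[_ /memv_imgP[f /mem_tailv[fV fi] ->]].
  rewrite lfunE memv0 /= => fi0.
  by rewrite asboolT //; exists f.
case: asboolP => // -[f [fV fi fi0]].
rewrite lt0n dimv_eq0 -subv0; apply: contra fi0 => /subvP W0.
by rewrite -memv0 W0 // -[coef_at i f]lfunE memv_img //; apply/mem_tailv.
Qed.

Hypothesis n_gt0 : (0 < n)%N.

Lemma coef_at_big i f : (n <= i)%N -> coef_at i f = 0.
Proof.
move=> ni; apply: big_coef_npoly; rewrite mk_monic_Xn size_polyXn.
by case: n n_gt0 ni.
Qed.

Lemma val_ge0 f : val_ge n f -> f = 0.
Proof.
move=> fn; apply/val_inj/polyP => i; rewrite /= coef0.
by rewrite -[LHS]/(coef_at i f); case: (ltnP i n) => [/fn|/coef_at_big->].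
Qed.

Lemma dim_exponent_set V : \dim V = #|exponent_set V|.
Proof.
have dimE i : \dim V = (\sum_(j < i) `[< has_val V j >] + \dim (tailv V i))%N.
  elim: i => [|i IHi]; first by rewrite big_ord0.
  by rewrite {}IHi dim_tailv big_ord_recr addnA.
rewrite (dimE n) [tailv V n](_ : _ = 0%VS); last first.
  apply/eqP; rewrite -subv0; apply/subvP => f /mem_tailv[_ /val_ge0->].
  exact: mem0v.
rewrite dimv0 addn0 -sum1_card [RHS]big_mkcond; apply: eq_bigr => j _ /=.
rewrite (_ : (j \in _) = `[< has_val V j >]); first by case: asboolP.
by apply/idP/asboolP => /mem_exponent_set.
Qed.

Lemma coef_at_in_qpoly i (p : {poly K}) : (i < n)%N ->
  coef_at i (in_qpoly 'X^n p) = p`_i.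
Proof.
move=> i_n; rewrite /coef_at /= [X in Pdiv.CommonRing.rmodp _ X]mk_monic_Xn.
by rewrite -Pdiv.RingMonic.take_poly_rmodp coef_take_poly prednK // i_n.
Qed.

Lemma coef_atM i f g : (i < n)%N ->
  coef_at i (f * g) = \sum_(j < i.+1) coef_at j f * coef_at (i - j)%N g.
Proof.
move=> i_n.
have -> : f * g = in_qpoly 'X^n ((f : {poly K}) * (g : {poly K})) by [].
by rewrite coef_at_in_qpoly // coefM.
Qed.

Lemma coef_at_one i : coef_at i 1 = (i == 0%N)%:R.
Proof. by rewrite /coef_at /= coef1. Qed.

Lemma val_geM i j f g : val_ge i f -> val_ge j g -> val_ge (i + j) (f * g).
Proof.
move=> fi gj k lt_k; have [k_n|/coef_at_big->//] := ltnP k n.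
rewrite coef_atM // big1 // => l _; have [/fi->|il] := ltnP l i.
  by rewrite mul0r.
by rewrite [coef_at _ g]gj ?mulr0 //; have := ltn_ord l; lia.
Qed.

Lemma lead_coefM i j f g : (i + j < n)%N -> val_ge i f -> val_ge j g ->
  coef_at (i + j) (f * g) = coef_at i f * coef_at j g.
Proof.
move=> ij_n fi gj; rewrite coef_atM //.
have lt_i : (i < (i + j).+1)%N by lia.
rewrite (bigD1 (Ordinal lt_i)) //= addKn big1 ?addr0 // => l ne_li.
have [/fi->|il] := ltnP l i; first by rewrite mul0r.
rewrite [coef_at _ g]gj ?mulr0 //.
move: ne_li; rewrite -val_eqE /= => /eqP ne_li; have := ltn_ord l; lia.
Qed.

End Valuations.

(** * The exchange property of exponents *)

(** [P] plays the part of the exponents of an algebra, which are closed only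
    under sums below the truncation, and [v] that of a valuation created by
    cancellation. *)
Section PartialMonoid.
Local Open Scope nat_scope.
Variables (P : nat -> Prop) (v : nat).
Hypothesis P0 : P 0.
Hypothesis PD : forall i j, P i -> P j -> i + j < v -> P (i + j).
Hypothesis Pv : forall i j, 0 < i -> 0 < j -> P i -> P j -> i + j <> v.

Lemma monoid_progression s e k : P s -> P e -> e + k * s < v -> P (e + k * s).
Proof.
move=> Ps Pe; elim: k => [|k IHk]; first by rewrite addn0.
by rewrite mulSnr addnA => lt_v; apply: PD => //; apply: IHk; lia.
Qed.

(** Otherwise v = (e + k s) + s with both summands in P. *)
Lemma indecomposable_mod s e :
  0 < s < v -> P s -> P e -> e < v -> ~~ (s %| v - e).
Proof.
move=> /andP[s_gt0 s_v] Ps Pe e_v; apply/negP => /dvdnP[[|k] def_v].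
  by lia.
have Pek : P (e + k * s) by apply: monoid_progression => //; lia.
have Pek0 : 0 < e + k * s by lia.
by have := Pv Pek0 s_gt0 Pek Ps; lia.
Qed.

(** The bound 12 is optimal: with v = 13 and the exponents 0, 4, 6, 8, 10, 12
    the equality 4 + 8 = 6 + 6 has no exchange. *)
Lemma exchange s t a b : v <= 12 -> 0 < s -> s <= a -> s <= b ->
    s + t = a + b -> a + b < v -> P s -> P t -> P a -> P b ->
  P (a - s) \/ P (b - s).
Proof.
move=> v12 s_gt0; wlog le_ab : a b / a <= b => [IH|].
  move=> sa sb stab ltv Ps Pt Pa Pb; have /orP[] := leq_total a b => le.
    exact: IH.
  by apply/or_comm; apply: IH => //; lia.
rewrite leq_eqVlt => /predU1P[<- *|lt_sa sb stab ltv Ps Pt Pa Pb].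
  by left; rewrite subnn.
have s_v : 0 < s < v by lia.
have mod0 : ~~ (s %| v - 0) by apply: indecomposable_mod => //; lia.
have moda : ~~ (s %| v - a) by apply: indecomposable_mod => //; lia.
have modb : ~~ (s %| v - b) by apply: indecomposable_mod => //; lia.
have modt : ~~ (s %| v - t) by apply: indecomposable_mod => //; lia.
have mulP x : s %| x -> x < v -> P x.
  case/dvdnP=> k -> lt_v.
  by have := monoid_progression Ps P0 (k := k); apply; lia.
have s4 : s <= 4 by lia.
have {s4} : [|| s == 1, s == 2, s == 3 | s == 4] by lia.
case/or4P=> /eqP s_eq;
  rewrite {}s_eq in lt_sa sb stab Ps s_v mod0 moda modb modt mulP *.
- by rewrite dvd1n in mod0.
(* Neither v nor v - a is even, so a is. *)
- by left; apply: mulP; lia.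
(* If neither a nor b is divisible by 3, they lie in the residue class other
   than that of v, so t = a + b - 3 is congruent to v. *)
- have [a3|a3] := boolP (3 %| a); first by left; apply: mulP; lia.
  have [b3|b3] := boolP (3 %| b); first by right; apply: mulP; lia.
  lia.
(* Here 5 <= a <= b and a + b <= 11, so a = 5, b is 5 or 6, and v > a + b. *)
- have P8 : 8 < v -> P 8 by exact: mulP.
  have [v11|v12'] : v = 11 \/ v = 12 by lia.
    have [a5 t6] : a = 5 /\ t = 6 by lia.
    by subst; case: (@Pv 5 6).
  by case: (@Pv 8 4) => //; apply: P8; lia.
Qed.
End PartialMonoid.

(** * Thinness as absence of new valuations *)

Section Thinness.
Variables (K : fieldType) (n : nat).
Hypothesis n_gt0 : (0 < n)%N.
Variable R : {aspace trunc_poly K n}.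
Implicit Types (f g h : trunc_poly K n).

Let m := max_ideal R.
Let E := exponent_set R.

Lemma memRM f g : f \in R -> g \in R -> f * g \in R.
Proof. by move=> fR gR; rewrite (subvP (asubv R)) ?memv_mul. Qed.

Lemma has_val0 : 1 \in R -> has_val R 0.
Proof.
by move=> R1; exists 1; split=> //; rewrite coef_at_one oner_neq0.
Qed.

Lemma has_valD i j :
  has_val R i -> has_val R j -> (i + j < n)%N -> has_val R (i + j).
Proof.
move=> [f [fR fi fi0]] [g [gR gj gj0]] ij_n; exists (f * g).
split; [exact: memRM | exact: val_geM | by rewrite lead_coefM ?mulf_neq0].
Qed.

Lemma max_ideal_tailv : m = tailv R 1.
Proof. by []. Qed.

Lemma has_val_max_ideal i : has_val m i <-> has_val R i /\ (0 < i)%N.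
Proof.
split=> [[f [fm fi fi0]]|[[f [fR fi fi0]] i_gt0]].
  move: fm; rewrite max_ideal_tailv => /mem_tailv[fR f0].
  split; first by exists f.
  by case: i fi fi0 => // _; rewrite f0 ?eqxx.
exists f; split=> //; rewrite max_ideal_tailv.
by apply/mem_tailv; split=> //; apply: val_geW fi.
Qed.

Lemma exponent_set_max_ideal : exponent_set m = pos_part E.
Proof.
apply/setP => i; rewrite [RHS]inE; apply/idP/andP.
  by case/mem_exponent_set/has_val_max_ideal => /mem_exponent_set.
by case=> /mem_exponent_set Ei i_gt0; apply/mem_exponent_set/has_val_max_ideal.
Qed.

Lemma double_sum_sub_sqr : double_sum E \subset exponent_set (m ^+ 2)%VS.
Proof.
apply/subsetP => k /double_sumP[i [j [i_gt0 j_gt0 Ei Ej kE]]].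
have [//|f [fm fi fi0]] := (has_val_max_ideal i).2.
have [//|g [gm gj gj0]] := (has_val_max_ideal j).2.
apply/mem_exponent_set; exists (f * g); rewrite kE expv2.
split; [exact: memv_mul | exact: val_geM |].
by rewrite lead_coefM ?mulf_neq0 // -kE.
Qed.

Lemma sqr_sub_pos_part : exponent_set (m ^+ 2)%VS \subset pos_part E.
Proof.
rewrite -exponent_set_max_ideal; apply/exponent_setS/max_ideal_sqr_sub.
exact: asubv.
Qed.

(** dim m/m^2 counts E_{>0} minus E(m^2), whereas d(E) counts E_{>0} minus
    E^(2), and E^(2) is contained in E(m^2). *)
Lemma thinP : thin R <-> exponent_set (m ^+ 2)%VS \subset double_sum E.
Proof.
have sDM := double_sum_sub_sqr; have sMP := sqr_sub_pos_part.
have cM := subset_leq_card sMP.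
rewrite /thin /cotangent_dim /num_gens !dim_exponent_set // -/E -/m.
rewrite exponent_set_max_ideal cardsD (setIidPr (subset_trans sDM sMP)).
split=> [eqc|sMD].
  suff/eqP->: double_sum E == exponent_set (m ^+ 2)%VS by [].
  rewrite eqEcard sDM; have := subset_leq_card sDM; lia.
suff -> : double_sum E = exponent_set (m ^+ 2)%VS by [].
by apply/eqP; rewrite eqEsubset sDM.
Qed.

(** * The filtration of the square of the maximal ideal *)

(** Restricting to 0 < i < k keeps both factors in the maximal ideal. *)
Definition products_ge k : {vspace trunc_poly K n} :=
  (\sum_(i < k | (0 < i)%N) tailv R i * tailv R (k - i))%VS.

Lemma mem_products_ge i j f g : (0 < i)%N -> (0 < j)%N ->
  f \in tailv R i -> g \in tailv R j -> f * g \in products_ge (i + j).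
Proof.
move=> i_gt0 j_gt0 fi gj; have lt_i : (i < i + j)%N by lia.
suff /subvP: (tailv R i * tailv R j <= products_ge (i + j))%VS.
  by apply; apply: memv_mul.
by apply: (sumv_sup (Ordinal lt_i)) => //=; rewrite addKn.
Qed.

Lemma products_ge_sub k (V : {vspace trunc_poly K n}) :
    (forall i j f g, (0 < i)%N -> (0 < j)%N -> (i + j)%N = k ->
       f \in tailv R i -> g \in tailv R j -> f * g \in V) ->
  (products_ge k <= V)%VS.
Proof.
move=> sV; apply/subv_sumP => i i_gt0; apply/prodvP => f g fi gj.
by apply: sV fi gj; have := ltn_ord i; lia.
Qed.

Lemma products_ge_val k h : h \in products_ge k -> val_ge k h.
Proof.
suff /subvP sub: (products_ge k <= tailv fullv k)%VS by move/sub/mem_tailv=> [].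
apply: products_ge_sub => i j f g _ _ <- /mem_tailv[_ fi] /mem_tailv[_ gj].
by apply/mem_tailv; split; [exact: memvf | exact: val_geM].
Qed.

Lemma max_ideal_sqr_products_ge : (m ^+ 2 <= products_ge 2)%VS.
Proof.
rewrite expv2; apply/prodvP => f g; rewrite max_ideal_tailv => f1 g1.
exact: (mem_products_ge _ _ f1 g1).
Qed.

Lemma tailvM i j f g :
  f \in tailv R i -> g \in tailv R j -> f * g \in tailv R (i + j).
Proof.
move=> /mem_tailv[fR fi] /mem_tailv[gR gj]; apply/mem_tailv.
by split; [exact: memRM | exact: val_geM].
Qed.

Lemma cancel_lead i f g : f \in tailv R i -> g \in tailv R i ->
  coef_at i g != 0 -> exists c, f - c *: g \in tailv R i.+1.
Proof.
move=> fi gi g0; exists (coef_at i f / coef_at i g).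
have /mem_tailv[hR hi] : f - (coef_at i f / coef_at i g) *: g \in tailv R i.
  by rewrite rpredB // rpredZ.
apply/mem_tailv; split=> //; apply: val_geS => //.
by rewrite linearB linearZ /= [_ *: _]mulfVK ?subrr.
Qed.

(** Up to scalars and terms of higher valuation f is a e and e g is b, so that
    f g is (a e) g = a (e g), that is a b. *)
Lemma exchange_products s d j f g a b e :
    (0 < s)%N -> (0 < j)%N -> (s + d < n)%N ->
    a \in tailv R s -> coef_at s a != 0 ->
    b \in tailv R (j + d) -> coef_at (j + d) b != 0 ->
    e \in tailv R d -> coef_at d e != 0 ->
    f \in tailv R (s + d) -> g \in tailv R j ->
  f * g \in (<[a * b]> + products_ge (s + d + j).+1)%VS.
Proof.
move=> s_gt0 j_gt0 sd_n aR a0 bR b0 eR e0 fR gR.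
have [c fc] : exists c, f - c *: (a * e) \in tailv R (s + d).+1.
  apply: cancel_lead => //; first exact: tailvM.
  have [[_ ?] [_ ?]] := ((mem_tailv R s a).1 aR, (mem_tailv R d e).1 eR).
  by rewrite lead_coefM ?mulf_neq0.
have [c' gc] : exists c', e * g - c' *: b \in tailv R (j + d).+1.
  by apply: cancel_lead => //; rewrite addnC; apply: tailvM.
have -> : f * g = (c * c') *: (a * b)
    + ((f - c *: (a * e)) * g + c *: (a * (e * g - c' *: b))).
  rewrite !mulrBl !mulrBr !scalerBr -!scalerAl -!scalerAr !scalerA mulrA.
  by rewrite subrKA addrC subrK.
rewrite memv_add ?memvZ ?memv_line //; apply: rpredD.
  by rewrite -addSn; apply: mem_products_ge.
apply: rpredZ.
have -> : ((s + d + j).+1 = s + (j + d).+1)%N by clear; lia.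
exact: mem_products_ge.
Qed.

Lemma coef_indecomposable k h : (k < n)%N ->
    (forall i j, (0 < i)%N -> (0 < j)%N -> has_val R i -> has_val R j ->
       (i + j)%N <> k) ->
  h \in products_ge k -> coef_at k h = 0.
Proof.
move=> k_n indec.
suff /subvP sub: (products_ge k <= lker (linfun (coef_at k)))%VS.
  by move/sub; rewrite memv_ker lfunE => /eqP.
apply: products_ge_sub => i j f g i_gt0 j_gt0 ijk.
move=> /mem_tailv[fR fi] /mem_tailv[gR gj].
rewrite memv_ker lfunE /= -ijk lead_coefM ?ijk // mulf_eq0.
apply/negPn; rewrite negb_or; apply/negP => /andP[f0 g0].
by case: (indec i j) => //; [exists f | exists g].
Qed.

(** All products of valuation k are proportional to a single a b modulo
    [products_ge k.+1], so an element of [products_ge k] without x^k term has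
    coefficient zero along a b. *)
Lemma products_geS k h : (k < n)%N ->
    (forall s t a b, (0 < s)%N -> (s <= a)%N -> (s <= b)%N ->
       (s + t)%N = k -> (a + b)%N = k ->
       has_val R s -> has_val R t -> has_val R a -> has_val R b ->
     has_val R (a - s) \/ has_val R (b - s)) ->
  h \in products_ge k -> coef_at k h = 0 -> h \in products_ge k.+1.
Proof.
move=> k_n exch hk hk0.
pose splits s := [&& (0 < s)%N, (s < k)%N, `[< has_val R s >]
  & `[< has_val R (k - s)%N >]].
(* If f g has no x^k term, one of its factors has a higher valuation. *)
have no_lead i j f g : (0 < i)%N -> (0 < j)%N -> (i + j)%N = k ->
    f \in tailv R i -> g \in tailv R j ->
    splits i && splits j \/ f * g \in products_ge k.+1.
  move=> i_gt0 j_gt0 ijk fi gj.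
  have [/mem_tailv[fR vf] /mem_tailv[gR vg]] := (fi, gj).
  have [f0|f0] := eqVneq (coef_at i f) 0.
    right; rewrite -ijk -addSn; apply: mem_products_ge => //.
    by apply/mem_tailv; split=> //; apply: val_geS.
  have [g0|g0] := eqVneq (coef_at j g) 0.
    right; rewrite -ijk -addnS; apply: mem_products_ge => //.
    by apply/mem_tailv; split=> //; apply: val_geS.
  have [Ei Ej] : has_val R i /\ has_val R j by split; [exists f | exists g].
  left; rewrite /splits -ijk addKn addnK !asboolT // !i_gt0 !j_gt0.
  by clear -i_gt0 j_gt0; lia.
have [/ex_minnP[s /and4P[s_gt0 s_k /asboolP Es /asboolP Et] s_min]|no_split] :=
    pselect (exists s, splits s); last first.
  suff /subvP: (products_ge k <= products_ge k.+1)%VS by apply.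
  apply: products_ge_sub => i j f g i_gt0 j_gt0 ijk fi gj.
  have [/andP[si _]|//] := no_lead i j f g i_gt0 j_gt0 ijk fi gj.
  by case: no_split; exists i.
have [[a [aR va a0]] [b [bR vb b0]]] := (Es, Et).
have as_ : a \in tailv R s by apply/mem_tailv.
have bt : b \in tailv R (k - s) by apply/mem_tailv.
have sub : (products_ge k <= <[a * b]> + products_ge k.+1)%VS.
  apply: products_ge_sub => i j f g i_gt0 j_gt0 ijk fi gj.
  have [/andP[si sj]|] := no_lead i j f g i_gt0 j_gt0 ijk fi gj; last first.
    exact/subvP/addvSr.
  have [si' sj'] := (s_min _ si, s_min _ sj).
  have [/and4P[_ _ /asboolP Ei _] /and4P[_ _ /asboolP Ej _]] := (si, sj).
  (* By commutativity it suffices to treat the case i - s in E. *)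
  have main i' j' f' g' : (0 < j')%N -> (i' + j')%N = k -> (s <= i')%N ->
      has_val R (i' - s) -> f' \in tailv R i' -> g' \in tailv R j' ->
      f' * g' \in (<[a * b]> + products_ge k.+1)%VS.
    move=> j'_gt0 ij'k le_s [e [eR ve e0]] fi' gj'.
    rewrite -{1}ij'k -{1}(subnKC le_s).
    apply: (@exchange_products s (i' - s) j' f' g' a b e) => //.
    - by clear -k_n j'_gt0 ij'k le_s; lia.
    - by rewrite addnBA // addnC ij'k.
    - by rewrite addnBA // addnC ij'k.
    - exact/mem_tailv.
    - by rewrite subnKC.
  have [E1|E2] :=
      exch s (k - s)%N i j s_gt0 si' sj' (subnKC (ltnW s_k)) ijk Es Et Ei Ej.
    exact: main fi gj.
  by rewrite mulrC; apply: main gj fi => //; rewrite addnC.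
have /memv_addP[_ /vlineP[c ->] [h' h'k def_h]] := subvP sub h hk.
have: coef_at k h = 0 := hk0.
rewrite def_h linearD linearZ /= (products_ge_val h'k) // addr0.
have sk := subnKC (ltnW s_k); rewrite -{1}sk lead_coefM ?sk //.
move/eqP; rewrite mulf_eq0 mulf_eq0 (negPf a0) (negPf b0) !orbF => /eqP->.
by rewrite scale0r add0r.
Qed.

End Thinness.

Lemma thin_le13 (K : fieldType) (n : nat) (R : {aspace trunc_poly K n}) :
  (0 < n <= 13)%N -> 1 \in R -> thin R.
Proof.
move=> /andP[n_gt0 n13] R1; apply/thinP => //; apply/subsetP => v.
have v_n := ltn_ord v.
case/mem_exponent_set=> h [hm vh]; apply: contraNT => /negP not_sum.
have hk k : (2 <= k <= v)%N -> h \in products_ge R k.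
  elim: k => // k IHk /andP[k1 k_v].
  have [k_le1|k_gt1] := leqP k 1.
    have -> : k.+1 = 2 by lia.
    exact: subvP (max_ideal_sqr_products_ge n_gt0 _) _ hm.
  apply: products_geS => //; first exact: ltn_trans k_v v_n; last first.
  - exact: vh.
  - by apply: IHk; lia.
  move=> s t a b s_gt0 sa sb st_k ab_k.
  apply: (exchange (v := v)) => //; try lia.
  - exact: has_val0.
  - by move=> i j Ei Ej ij; apply: has_valD => //; lia.
  move=> i j i_gt0 j_gt0 Ei Ej ij; apply: not_sum; apply/double_sumP.
  by exists i, j; split.
apply/eqP; have [v1|v_gt1] := leqP v 1.
  have h2 := subvP (max_ideal_sqr_products_ge n_gt0 _) _ hm.
  exact: (products_ge_val n_gt0 h2).
apply: coef_indecomposable (hk v _) => //; last by lia.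
move=> i j i_gt0 j_gt0 Ei Ej ij; apply: not_sum; apply/double_sumP.
by exists i, j.
Qed.

(** * A non-thin algebra *)

Section NonThin.
Variables (K : fieldType) (n : nat).
Hypothesis n_gt11 : (11 < n)%N.
Implicit Types f g : trunc_poly K n.

Let c i := linfun (@coef_at K n i).

(** With f4 = x^4 + x^5 and f6 = x^6 + x^7, these equations cut out the span of
    1, f4, f6, f4^2 = x^8 + 2 x^9 + x^10, f4 f6 = x^10 + 2 x^11 + x^12 and the
    multiples of x^12.  For equations, unlike for a span, closure under products
    is a computation with coefficients. *)
Definition nonthin_space : {vspace trunc_poly K n} :=
  (\bigcap_(l <- [:: c 1; c 2; c 3; (c 5 - c 4)%R; (c 7 - c 6)%R;
     (c 9 - 2 *: c 8)%R; (c 11 - 2 *: (c 10 - c 8))%R]) lker l)%VS.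

Lemma mem_nonthin_space f :
  (f \in nonthin_space) <->
  [/\ coef_at 1 f = 0, coef_at 2 f = 0 & coef_at 3 f = 0] /\
   [/\ coef_at 5 f = coef_at 4 f, coef_at 7 f = coef_at 6 f,
       coef_at 9 f = 2 * coef_at 8 f &
       coef_at 11 f = 2 * (coef_at 10 f - coef_at 8 f)].
Proof.
rewrite /nonthin_space !big_cons big_nil capvf !memv_cap !memv_ker.
rewrite !(add_lfunE, opp_lfunE, scale_lfunE, lfunE) /= !subr_eq0.
split.
  case/and5P=> /eqP-> /eqP-> /eqP-> /eqP-> /and3P[/eqP-> /eqP-> /eqP->].
  by [].
by case=> [[-> -> ->] [-> -> -> ->]]; rewrite !eqxx.
Qed.

Lemma nonthin_space_is_aspace : is_aspace nonthin_space.
Proof.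
have n_gt0 : (0 < n)%N by apply: leq_trans n_gt11.
apply/andP; split.
  apply/has_algid1/mem_nonthin_space; rewrite !coef_at_one /=.
  by rewrite !(subr0, mulr0).
apply/prodvP => f g /mem_nonthin_space[[f1 f2 f3] [f5 f7 f9 f11]].
case/mem_nonthin_space=> [[g1 g2 g3] [g5 g7 g9 g11]].
have lt_n i : (i <= 11)%N -> (i < n)%N by move/leq_ltn_trans; apply.
apply/mem_nonthin_space; rewrite !coef_atM ?lt_n // !big_ord_recr !big_ord0 /=.
rewrite ?subn0 ?subnn !subSS ?subn0.
rewrite f1 f2 f3 f5 f7 f9 f11 g1 g2 g3 g5 g7 g9 g11.
split; split; ring.
Qed.

End NonThin.

Section NonThinExample.
Variables (K : fieldType) (n : nat).
Hypothesis n_gt13 : (13 < n)%N.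

Let n_gt11 : (11 < n)%N. Proof. exact: leq_trans n_gt13. Qed.
Let n_gt0 : (0 < n)%N. Proof. exact: leq_trans n_gt13. Qed.

Definition nonthin_alg : {aspace trunc_poly K n} :=
  ASpace (nonthin_space_is_aspace K n_gt11).

Lemma nonthin_alg1 : 1 \in nonthin_alg.
Proof.
by apply/mem_nonthin_space; rewrite !coef_at_one /= !(subr0, mulr0).
Qed.

Lemma nonthin_alg_val i :
  has_val nonthin_alg i -> i \in [:: 0; 4; 6; 8; 10]%N \/ (12 <= i)%N.
Proof.
case=> f [/mem_nonthin_space[[f1 f2 f3] [f5 f7 f9 f11]] fi fi0].
have [lt|] := ltnP i 12; last by right.
left; move: lt fi fi0; (do 12?[case: i => [|i]]) => // _ fi.
- by rewrite f1 eqxx.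
- by rewrite f2 eqxx.
- by rewrite f3 eqxx.
- by rewrite f5 fi ?eqxx.
- by rewrite f7 fi ?eqxx.
- by rewrite f9 fi ?mulr0 ?eqxx.
- by rewrite f11 !fi ?subrr ?mulr0 ?eqxx.
Qed.

Lemma mem_binomial_generator k : k \in [:: 4; 6]%N ->
  in_qpoly 'X^n ('X^k + 'X^(k.+1)) \in max_ideal nonthin_alg.
Proof.
have lt_n i : (i <= 13)%N -> (i < n)%N by move/leq_ltn_trans; apply.
rewrite !inE => k46; rewrite mem_max_ideal -[_`_0]/(coef_at 0 _).
rewrite coef_at_in_qpoly // coefD !coefXn; apply/andP; split; last first.
  by case/pred2P: k46 => -> /=; rewrite addr0.
apply/mem_nonthin_space; rewrite !coef_at_in_qpoly ?lt_n //.
by case/pred2P: k46 => ->;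
  rewrite !coefD !coefXn /= !(mulr0n, addr0, add0r, oppr0, mulr0).
Qed.

(** The coefficient of x^13 in f4^3 - f6^2 is 3 - 2 = 1, whatever the
    characteristic of K. *)
Lemma nonthin_alg_not_thin : ~ thin nonthin_alg.
Proof.
move/(thinP n_gt0)/subsetP/(_ (Ordinal n_gt13)).
case/(_ _)/double_sumP; last first.
  move=> i [j [i_gt0 j_gt0 /nonthin_alg_val Ei /nonthin_alg_val Ej /= ij]].
  by move: Ei Ej; rewrite !inE; lia.
pose f4 : trunc_poly K n := in_qpoly _ ('X^4 + 'X^5).
pose f6 : trunc_poly K n := in_qpoly _ ('X^6 + 'X^7).
have f4m : f4 \in max_ideal nonthin_alg by exact: mem_binomial_generator.
have f6m : f6 \in max_ideal nonthin_alg by exact: mem_binomial_generator.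
have f4f4m : f4 * f4 \in max_ideal nonthin_alg.
  have /max_ideal_sqr_sub/subvP-> // := asubv nonthin_alg.
  by rewrite expv2 memv_mul.
have cancel46 : f4 * (f4 * f4) - f6 * f6 = in_qpoly _ ('X^13 * (1 + 'X) ^+ 2).
  have -> : 'X^13 * (1 + 'X) ^+ 2 =
      ('X^4 + 'X^5) * (('X^4 + 'X^5) * ('X^4 + 'X^5))
      - ('X^6 + 'X^7) * ('X^6 + 'X^7) :> {poly K} by ring.
  by rewrite rmorphB /= !in_qpolyM.
apply/mem_exponent_set; exists (f4 * (f4 * f4) - f6 * f6); split.
- by rewrite expv2 rpredB ?memv_mul.
- move=> j /= j13; rewrite cancel46 coef_at_in_qpoly //.
    by rewrite coefXnM j13.
  exact: ltn_trans n_gt13.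
rewrite /= cancel46 coef_at_in_qpoly // coefXnM ltnn subnn expr2 coef0M.
by rewrite coefD coef1 coefX addr0 mulr1 oner_neq0.
Qed.

End NonThinExample.

Theorem theorem3 (K : fieldType) :
  (exists R : {aspace trunc_poly K 14}, 1 \in R /\ ~ thin R) /\
  (forall n : nat, (1 <= n <= 13)%N ->
     forall R : {aspace trunc_poly K n}, 1 \in R -> thin R).
Proof.
split=> [|n n_bnd R]; last exact: thin_le13.
exists (nonthin_alg K (isT : (13 < 14)%N)); split.
  exact: nonthin_alg1.
exact: nonthin_alg_not_thin.
Qed.
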